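(* Let $P$ be an $n\times n$ irreducible stochastic matrix with stationary distribution vector $\boldsymbol{\pi}$, partitioned as $P=\begin{bmatrix}P_{11}&P_{12}\\P_{21}&P_{22}\end{bmatrix}$ with $P_{11}$ of size $m\times m$ and $P_{22}$ of size $(n-m)\times(n-m)$, $1\le m\le n-1$. Let $P_1=P_{11}+P_{12}(I-P_{22})^{-1}P_{21}$, $P_2=P_{22}+P_{21}(I-P_{11})^{-1}P_{12}$, partition $\boldsymbol{\pi}^T=[\boldsymbol{\pi}_1^T\ \boldsymbol{\pi}_2^T]$ conformally, let $\hat{\boldsymbol{\pi}}_i=\boldsymbol{\pi}_i/\|\boldsymbol{\pi}_i\|$, let $\gamma=\kappa(P)-\kappa(P_1)-\kappa(P_2)$, and let $$\theta=\hat{\boldsymbol{\pi}}_2^T\left(I+(I-P_{22})^{-1}P_{21}(I-P_1+\mathbf{1}\hat{\boldsymbol{\pi}}_1^T)^{-1}P_{12}\right)(I-P_{22})^{-1}\mathbf{1}.$$ Then $$\theta\le\|(I-P_{22})^{-1}\|_\infty\left(1+\|P_{12}\|_\infty\|(I-P_1+\mathbf{1}\hat{\boldsymbol{\pi}}_1^T)^{-1}\|_\infty\right).$$ If moreover $\|P_{11}\|_\infty<1$ and $\|P_{22}\|_\infty<1$, then $$\frac{1-\|P_{22}\|_\infty}{1-\|P_{22}\|_\infty+\|P_{12}\|_\infty}\le\|\boldsymbol{\pi}_1\|\le\frac{\|P_{21}\|_\infty}{1-\|P_{11}\|_\infty+\|P_{21}\|_\infty}.$$ Under the same norm assumptions,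 if $1+\theta\ge0$, then $$(\theta+1)\frac{1-\|P_{22}\|_\infty}{1-\|P_{22}\|_\infty+\|P_{12}\|_\infty}-1\le\gamma\le(\theta+1)\frac{\|P_{21}\|_\infty}{1-\|P_{11}\|_\infty+\|P_{21}\|_\infty}-1,$$ and a similar inequality holds if $1+\theta<0$, namely the one with the two bounds interchanged: $$(\theta+1)\frac{\|P_{21}\|_\infty}{1-\|P_{11}\|_\infty+\|P_{21}\|_\infty}-1\le\gamma\le(\theta+1)\frac{1-\|P_{22}\|_\infty}{1-\|P_{22}\|_\infty+\|P_{12}\|_\infty}-1.$$
   Context: A square nonnegative matrix $P$ is stochastic if $P\mathbf{1}=\mathbf{1}$, where $\mathbf{1}$ is the all-ones vector of appropriate size. The stationary distribution vector of an irreducible stochastic $P$ is the unique vector $\boldsymbol{\pi}$ with $\boldsymbol{\pi}^TP=\boldsymbol{\pi}^T$, $\boldsymbol{\pi}^T\mathbf{1}=1$ (it is entrywise positive). For vectors, $\|\cdot\|$ is the 1-norm; for matrices, $\|\cdot\|_\infty$ is the norm induced by the vector infinity norm (maximum absolute row sum). Since $P$ is irreducible, $I-P_{11}$ and $I-P_{22}$ are nonsingular, and the stochastic complements $P_1,P_2$ are stochastic and irreducible; $\hat{\boldsymbol{\pi}}_i$ is the stationary distribution vector of $P_i$. One has $\gamma=(1+\theta)\|\boldsymbol{\pi}_1\|-1$. Kemeny's constant of an irreducible stochastic $N\times N$ matrix $Q$ with eigenvalues $\lambda_1=1,\lambda_2,\dots,\lambda_N$ (with algebraic multiplicity) is $\kappa(Q)=\sum_{i=2}^N\frac{1}{1-\lambda_i}$;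 equivalently $\kappa(Q)=\operatorname{Tr}\big((I-Q+\mathbf{1}\mathbf{h}^T)^{-1}\big)-1$ for any $\mathbf{h}$ with $\mathbf{h}^T\mathbf{1}=1$. *)

(* Defs.v *)
From HB Require Import structures.
From mathcomp Require Import all_boot all_order perm all_algebra.
From mathcomp Require Import reals complex.

Set Implicit Arguments.
Unset Strict Implicit.
Unset Printing Implicit Defensive.

Import Order.TTheory GRing.Theory Num.Theory.
Local Open Scope ring_scope.
Local Open Scope complex_scope.

Section Defs.
Variable R : realType.

Definition ones n : 'cV[R]_n := const_mx 1.

Definition nonneg_mx m n (A : 'M[R]_(m, n)) : Prop := forall i j, 0 <= A i j.

Definition stochastic n (P : 'M[R]_n) : Prop :=
  nonneg_mx P /\ P *m ones n = ones n.

(* Some simultaneous permutation of rows and columns brings P to a block upper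
   triangular form with two diagonal blocks of positive sizes r and n - r. *)
Definition reducible n (P : 'M[R]_n) : Prop :=
  exists (s : 'S_n) (r : nat), (0 < r < n)%N /\
    forall i j : 'I_n, (r <= i)%N -> (j < r)%N ->
      row_perm s (col_perm s P) i j = 0.

Definition irreducible n (P : 'M[R]_n) : Prop := ~ reducible P.

(* The row vector p stands for the transpose of the column vector pi. *)
Definition stationary n (P : 'M[R]_n) (p : 'rV[R]_n) : Prop :=
  p *m P = p /\ p *m ones n = 1%:M.

Definition norm_l1 n (p : 'rV[R]_n) : R := \sum_j `|p 0 j|.

(* Maximum absolute row sum; the absolute row sums being nonnegative, the
   default value 0 of the maximum is harmless. *)
Definition norm_inf m n (A : 'M[R]_(m, n)) : R :=
  \big[Num.max/0]_i \sum_j `|A i j|.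

(* The complex eigenvalues, listed with algebraic multiplicity: the roots of
   the (monic) characteristic polynomial. *)
Definition eigenvalues n (Q : 'M[R]_n) : seq R[i] :=
  sval (closed_field_poly_normal (char_poly (map_mx (real_complex R) Q))).

(* [rem 1] drops one occurrence of the eigenvalue 1, i.e. lambda_1. The sum is
   a complex number; between elements of R[i], x <= y means that y - x is real
   and nonnegative, so comparing with a real number includes being real. *)
Definition kemeny n (Q : 'M[R]_n) : R[i] :=
  \sum_(l <- rem 1 (eigenvalues Q)) (1 - l)^-1.

End Defs.

(* Main.v *)
Require Import Defs.
From HB Require Import structures.
From mathcomp Require Import all_boot all_order perm all_algebra.
From mathcomp Require Import reals complex.
From mathcomp Require Import ring lra.

Set Implicit Arguments.
Unset Strict Implicit.
Unset Printing Implicit Defensive.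

Import Order.TTheory GRing.Theory Num.Theory.
Local Open Scope ring_scope.
Local Open Scope complex_scope.

(** Kemeny's constant is Tr (I - Q + 1 h)^-1 - 1 for every row h of mass 1, so
h can be chosen separately for each matrix. With h = (hatpi_1, 0), resp. (0,
hatpi_2), block elimination expresses the trace of the diagonal block 1, resp.
2, of the inverse for P through the trace of the fundamental matrix of P_1,
resp. P_2. The two inverses for P differ by a rank-one term, which is evaluated
by solving (I - P) v = (0, 1) - |pi_2| 1; this yields gamma = (1 + theta)
|pi_1| - 1. The bounds on |pi_1| follow from taking 1-norms in pi_i = pi_1 P_1i
+ pi_2 P_2i, and the bound on theta from the fact that (I - P_22)^-1 P_21 is
nonnegative with unit row sums. Invertibility and positivity come from the
minimum principle for irreducible stochastic matrices. *)

(** * Kemeny's constant as a trace *)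

Lemma unitmx_of_ker (F : fieldType) n (A : 'M[F]_n) :
  (forall z : 'cV_n, A *m z = 0 -> z = 0) -> A \in unitmx.
Proof.
move=> kerA; rewrite -unitmx_tr -row_free_unit -kermx_eq0.
apply/eqP/row_matrixP => i; rewrite row0; apply: trmx_inj; rewrite trmx0.
apply: kerA; apply: trmx_inj; rewrite trmx_mul trmxK trmx0.
by rewrite -row_mul mulmx_ker row0.
Qed.

(* The determinant of [[1, -v], [u, D]], with D u = t u and v u = 1, is computed
   by eliminating either u by row operations or v by column operations. *)
Lemma det_rank_one_update (R : comPzRingType) n (D : 'M[R]_n) (u : 'cV_n)
    (v : 'rV_n) t :
  D *m u = t *: u -> v *m u = 1%:M ->
  t * \det (D + u *m v) = (t + 1) * \det D.
Proof.
move=> Du vu.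
pose N := block_mx (1%:M : 'M_1) (- v) u D.
have detN : \det N = \det (D + u *m v).
  have : \det (block_mx (1%:M : 'M_1) 0 (- u) 1%:M *m N) = \det (D + u *m v).
    rewrite mulmx_block !mul1mx !mul0mx !addr0 mulmx1 mulNmx mulmxN opprK.
    by rewrite addNr addrC det_ublock det1 mul1r.
  by rewrite det_mulmx det_lblock !det1 !mul1r.
have : \det (N *m block_mx (t%:M : 'M_1) 0 (- u) 1%:M) = (t + 1) * \det D.
  rewrite mulmx_block !mulmx0 !mulmx1 !add0r mul1mx mulNmx mulmxN opprK vu.
  rewrite mulmxN Du mul_mx_scalar subrr det_ublock det_mx11 !mxE eqxx.
  by rewrite !mulr1n.
by rewrite det_mulmx det_lblock det1 mulr1 detN det_mx11 mxE eqxx mulr1n mulrC.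
Qed.

(** Over polynomials [u] is an eigenvector of ['X - Q] for ['X - 1], so the determinant identity
    applies with [t = 'X - 1]. *)
Lemma char_poly_rank_one_update (F : fieldType) n (Q : 'M[F]_n) (u : 'cV_n)
    (v : 'rV_n) :
  Q *m u = u -> v *m u = 1%:M ->
  ('X - 1) * char_poly (Q - u *m v) = 'X * char_poly Q.
Proof.
move=> Qu vu.
have := @det_rank_one_update _ n (char_poly_mx Q) (map_mx polyC u)
  (map_mx polyC v) ('X - 1).
rewrite subrK -map_mxM -/(char_poly Q) => <-.
- by rewrite /char_poly /char_poly_mx map_mxB opprD opprK addrA map_mxM.
- by rewrite /char_poly_mx mulmxBl -map_mxM Qu mul_scalar_mx scalerBl scale1r.
- by rewrite vu map_scalar_mx.
Qed.

Lemma horner_inj (F : numDomainType) (f g : {poly F}) :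
  (forall x, x != 0 -> f.[x] = g.[x]) -> f = g.
Proof.
move=> fg; apply/eqP; rewrite -subr_eq0; apply/eqP/eqP; apply: contraT => nz.
(* The integers 1, 2, ... are nonzero and, in characteristic 0, distinct, so a nonzero [f - g] would
   have too many roots. *)
pose rs := [seq (i.+1)%:R | i <- iota 0 (size (f - g))] : seq F.
have := @max_poly_roots _ _ rs nz.
rewrite size_map size_iota ltnn => -> //.
  apply/allP => x /mapP[i _ ->]; rewrite /root hornerD hornerN fg ?subrr //.
  by rewrite pnatr_eq0.
rewrite map_inj_uniq ?iota_uniq // => i j /eqP; rewrite eqr_nat => /eqP.
by case.
Qed.

Lemma horner_char_poly (F : comNzRingType) n (M : 'M[F]_n) x :
  (char_poly M).[x] = \det (x%:M - M).
Proof.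
rewrite -[LHS]/(horner_eval x _) /char_poly -det_map_mx; congr (\det _).
apply/matrixP=> i j; rewrite !mxE /= /horner_eval hornerD hornerN hornerC.
by rewrite hornerMn hornerX.
Qed.

(** With Z the inverse of 1 - M and x nonzero, det (x - Z) det (1 - M) = x^n det ((1 - x^-1) - M).
    Hence Z has the eigenvalues (1 - l)^-1, and its trace is read off the coefficient of X^(n-1). *)
Lemma trace_inv_sub (F : numFieldType) n (M : 'M[F]_n) (s : seq F) :
  char_poly M = \prod_(l <- s) ('X - l%:P) -> 1%:M - M \in unitmx ->
  \tr (invmx (1%:M - M)) = \sum_(l <- s) (1 - l)^-1.
Proof.
move=> charM uM.
have szs : size s = n.
  by have := size_char_poly M; rewrite charM size_prod_XsubC => -[].
(* [char_poly_trace] asks for n > 0; for n = 0 both sides are empty sums. *)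
case: (posnP n) => [n0|n_gt0].
  rewrite n0 in szs; rewrite (size0nil szs) big_nil.
  rewrite /mxtrace big1 // => i; have := leq_ltn_trans (leq0n i) (ltn_ord i).
  by rewrite [X in (_ < X)%N]n0.
have hM x : \det (x%:M - M) = \prod_(l <- s) (x - l).
  rewrite -horner_char_poly charM horner_prod.
  by apply: eq_bigr => l _; rewrite hornerXsubC.
have nz : \prod_(l <- s) (1 - l) != 0.
  by rewrite -hM -unitfE.
set Z := invmx _.
have charZ : char_poly Z = \prod_(l <- [seq (1 - l)^-1 | l <- s]) ('X - l%:P).
  apply: horner_inj => x x0; apply: (mulIf nz).
  rewrite horner_char_poly -{1}hM -det_mulmx.
  rewrite horner_prod big_map -big_split /=.
  rewrite mulmxBl mulVmx // mul_scalar_mx.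
  have -> : x *: (1%:M - M) - 1%:M = x *: ((1 - x^-1)%:M - M).
    rewrite !scalerBr raddfB /= scalerBr !scale_scalar_mx mulfV // mulr1.
    by rewrite addrAC.
  rewrite detZ hM -{1}szs -[size s]count_predT.
  rewrite -iter_mulr_1 -big_const_seq -big_split /=.
  rewrite !big_seq; apply: eq_bigr => l ls.
  have l1 : 1 - l != 0.
    by apply: contraNneq nz => l1; rewrite (big_rem l ls) /= l1 mul0r.
  by rewrite hornerXsubC; field; rewrite l1.
have := char_poly_trace Z n_gt0.
rewrite charZ -{1}szs -(size_map (fun l => (1 - l)^-1) s).
rewrite coefPn_prod_XsubC ?size_map ?szs -?lt0n // => /oppr_inj <-.
by rewrite big_map.
Qed.

(* Subtracting 1 h moves the eigenvalue 1 of Q to 0 and keeps the others. *)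
Lemma kemeny_trace (R : realType) n (Q : 'M[R]_n) (h : 'rV_n) :
  Q *m ones R n = ones R n -> h *m ones R n = 1%:M ->
  1%:M - Q + ones R n *m h \in unitmx ->
  kemeny Q = (\tr (invmx (1%:M - Q + ones R n *m h)) - 1)%:C.
Proof.
move=> Q1 h1 uQ.
pose c := real_complex R.
have charQ : char_poly (map_mx c Q) = \prod_(l <- eigenvalues Q) ('X - l%:P).
  rewrite /eigenvalues; case: closed_field_poly_normal => s /= {1}->.
  by rewrite (monicP (char_poly_monic _)) scale1r.
have Q1c : map_mx c Q *m map_mx c (ones R n) = map_mx c (ones R n).
  by rewrite -map_mxM Q1.
have h1c : map_mx c h *m map_mx c (ones R n) = 1%:M.
  by rewrite -map_mxM h1 map_scalar_mx rmorph1.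
have charM := char_poly_rank_one_update Q1c h1c.
(* Evaluating [charM] at 1 shows that 1 is an eigenvalue, so [rem 1] does remove an entry. *)
have in1 : 1 \in eigenvalues Q.
  rewrite -root_prod_XsubC -charQ /root; apply/eqP.
  have := congr1 (fun p => p.[1]) charM.
  by rewrite /= !hornerM hornerX mul1r hornerXsubC subrr mul0r.
rewrite charQ (big_rem _ in1) /= mulrCA in charM.
move/(mulfI (negbT (polyXsubC_eq0 1))): charM => charM.
(* The eigenvalue 0 that replaces 1 contributes 1 / (1 - 0), which is the 1 subtracted in the
   statement. *)
have := @trace_inv_sub _ n (map_mx c Q - map_mx c (ones R n) *m map_mx c h)
   (0 :: rem 1 (eigenvalues Q)).
have -> : 1%:M - (map_mx c Q - map_mx c (ones R n) *m map_mx c h) =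
          map_mx c (1%:M - Q + ones R n *m h).
  by rewrite map_mxD map_mxB map_mxM map_scalar_mx rmorph1 opprB addrA addrAC.
rewrite -map_invmx trace_map_mx !big_cons !subr0 invr1 => tr.
rewrite rmorphB /= tr ?map_unitmx //.
by rewrite rmorph1 addrC addKr.
Qed.

(** * Minimum principle *)

Section Irreducible.
Variables (R : realType) (n : nat) (P : 'M[R]_n).
Hypothesis Pirr : irreducible P.

(** Listing the complement of a closed set first and the set itself second permutes [P] into block
    triangular form, unless one of the two is empty. *)
Lemma irreducible_closed (S : {set 'I_n}) :
  (forall i j, i \in S -> j \notin S -> P i j = 0) -> S != set0 -> S = setT.
Proof.
move=> closedS S0; apply/eqP/negPn/negP => ST; apply: Pirr.
pose t := enum (~: S) ++ enum S.
have szt : size t == n by rewrite size_cat -!cardE addnC cardsC card_ord.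
have ut : uniq t.
  rewrite cat_uniq !enum_uniq andbT /=; apply/hasPn => i.
  by rewrite !mem_enum inE negbK.
pose f := tnth (Tuple szt).
have inj_f : injective f by apply/tuple_uniqP.
exists (perm inj_f), #|~: S|; split.
  apply/andP; split; first by rewrite card_gt0 -subset0 subCset setC0 subTset.
  by rewrite -[X in (_ < X)%N](card_ord n) -(cardsC S) -[X in (X < _)%N]add0n
    ltn_add2r card_gt0.
have fE i : f i = nth i t i by apply: tnth_nth.
move=> i j le_i lt_j; rewrite !mxE !permE; apply: closedS.
  rewrite fE nth_cat -cardE ltnNge le_i /= -mem_enum; apply: mem_nth.
  by rewrite -cardE ltn_subLR // addnC cardsC card_ord.
rewrite fE nth_cat -cardE lt_j -in_setC -mem_enum; apply: mem_nth.
by rewrite -cardE.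
Qed.

Hypothesis Psto : stochastic P.

Lemma stochastic_row_sum i : \sum_j P i j = 1.
Proof.
have /matrixP/(_ i 0) := Psto.2; rewrite !mxE => <-.
by apply: eq_bigr => j _; rewrite mxE mulr1.
Qed.

(** The minimisers form a closed set: at one of them the second hypothesis makes a weighted sum of
    nonnegative differences nonpositive, so every transition of positive probability leads to a
    minimiser. *)
Lemma minimum_principle (x : 'cV[R]_n) i0 :
  (forall j, x i0 0 <= x j 0) ->
  (forall i, x i 0 = x i0 0 -> (P *m x) i 0 <= x i 0) ->
  forall j, x j 0 = x i0 0.
Proof.
move=> min_x super j.
suff : j \in [set i | x i 0 == x i0 0] by rewrite inE => /eqP.
set S := [set _ | _].
rewrite [S]irreducible_closed ?inE //; last first.
  by apply/set0Pn; exists i0; rewrite inE.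
move=> i k; rewrite !inE => /eqP xi xk.
have ge0 l : true -> 0 <= P i l * (x l 0 - x i 0).
  by move=> _; rewrite mulr_ge0 ?Psto.1 // subr_ge0 xi.
have sum0 : \sum_l P i l * (x l 0 - x i 0) = 0.
  apply/eqP; rewrite eq_le sumr_ge0 // andbT.
  have := super i xi; rewrite mxE -subr_le0.
  rewrite -[X in _ - X]mul1r -(stochastic_row_sum i) mulr_suml -sumrB.
  by under eq_bigr do rewrite -mulrBr.
have /(_ k isT)/eqP := psumr_eq0P ge0 sum0.
by rewrite mulf_eq0 subr_eq0 xi (negPf xk) orbF => /eqP.
Qed.

Lemma harmonic_const (x : 'cV[R]_n) :
  P *m x = x -> exists c, x = c *: ones R n.
Proof.
move=> Px; case: (pickP (fun _ : 'I_n => true)) => [i0 _|n0]; last first.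
  by exists 0; apply/matrixP=> i; have := n0 i.
have [i _ min_i] := arg_minP (fun i => x i 0) (isT : xpredT i0).
exists (x i 0); apply/matrixP=> j j'; rewrite (ord1 j') !mxE mulr1.
by apply: minimum_principle => [l|l _]; rewrite ?Px // min_i.
Qed.

(** The support is closed: where q vanishes, the nonnegative inflows sum to zero, so no transition
    leads there from the support. *)
Lemma invariant_support (q : 'rV[R]_n) :
  (forall j, 0 <= q 0 j) -> q *m P = q -> q != 0 -> forall j, 0 < q 0 j.
Proof.
move=> q0 qP qn0 j; rewrite lt_def q0 andbT.
suff : j \in [set i | q 0 i != 0] by rewrite inE.
set S := [set _ | _].
rewrite [S]irreducible_closed ?inE //; last first.
  by apply: contraNneq qn0 => S0; apply/eqP/rowP => i; move/setP/(_ i): S0;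
     rewrite !inE mxE => /negbFE/eqP.
move=> i k; rewrite !inE negbK => qi /eqP qk.
have /rowP/(_ k) := qP; rewrite qk mxE => sum0.
have ge0 l : true -> 0 <= q 0 l * P l k by rewrite mulr_ge0 ?Psto.1.
have /(_ i isT)/eqP := psumr_eq0P ge0 sum0.
by rewrite mulf_eq0 (negPf qi) => /eqP.
Qed.

(** Stationarity as defined prescribes no sign. The row |p| is invariant too, so |p| + p is a
    nonnegative invariant row, nonzero because p has mass 1, hence positive everywhere. *)
Lemma stationary_gt0 (p : 'rV[R]_n) : stationary P p -> forall j, 0 < p 0 j.
Proof.
move=> [pP p1] j.
pose a := map_mx Num.norm p.
have le_a i : a 0 i <= (a *m P) 0 i.
  rewrite mxE -{1}pP mxE; apply: le_trans (ler_norm_sum _ _ _) _.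
  rewrite [leRHS]mxE; apply: ler_sum => l _.
  by rewrite normrM mxE (ger0_norm (Psto.1 _ _)).
(* The two sides of [le_a] have the same total mass, since [P] preserves mass, so the inequality is
   an equality. *)
have aP : a *m P = a.
  apply/rowP => i; apply/eqP; rewrite -subr_eq0; apply/eqP.
  have ge0 l : true -> 0 <= (a *m P) 0 l - a 0 l by rewrite subr_ge0.
  apply: (psumr_eq0P ge0 _ isT).
  have : (a *m P *m ones R n) 0 0 = (a *m ones R n) 0 0.
    by rewrite -mulmxA Psto.2.
  rewrite mxE [RHS]mxE => /eqP; rewrite -subr_eq0 -sumrB => /eqP sum0.
  rewrite -[RHS]sum0; apply: eq_bigr => l _.
  by rewrite [ones R n l 0]mxE !mulr1.
pose q := a + p.
have q0 i : 0 <= q 0 i.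
  by rewrite !mxE -lerBlDr sub0r -normrN ler_norm.
have qP : q *m P = q by rewrite mulmxDl aP pP.
have qn0 : q != 0.
  apply/eqP => /rowP qE.
  have sum1 : \sum_i p 0 i = 1.
    have /matrixP/(_ 0 0) := p1; rewrite !mxE mulr1n => <-.
    by apply: eq_bigr => l _; rewrite mxE mulr1.
  have : \sum_i p 0 i <= 0.
    apply: sumr_le0 => i _; have := qE i; rewrite !mxE => /eqP.
    by rewrite addrC addr_eq0 => /eqP ->; rewrite oppr_le0.
  by rewrite sum1 ler10.
have := invariant_support q0 qP qn0 j; rewrite !mxE.
by case: (ltrgt0P (p 0 j)) => [//|_|->]; rewrite ?addNr ?addr0 ltxx.
Qed.

(** A negative minimum would spread to every state, [b] included. The state [b] acts as the boundary
    of a chain killed on leaving a block. *)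
Lemma superharmonic_ge0 (x : 'cV[R]_n) b :
  x b 0 = 0 -> (forall i, x i 0 < 0 -> (P *m x) i 0 <= x i 0) ->
  forall i, 0 <= x i 0.
Proof.
move=> xb super i.
have [i0 _ min_i0] := arg_minP (fun i => x i 0) (isT : xpredT b).
apply: le_trans (min_i0 i isT); rewrite leNgt; apply/negP => lt0.
have super0 l : x l 0 = x i0 0 -> (P *m x) l 0 <= x l 0.
  by move=> xl; apply: super; rewrite xl.
have := minimum_principle (fun j => min_i0 j isT) super0 b.
by rewrite xb => E; move: lt0; rewrite -E ltxx.
Qed.

(** For z in the kernel, multiplying by p gives h z = 0; then z is harmonic, hence constant, and h z
    = 0 makes the constant 0. *)
Lemma fundamental_unit (p h : 'rV[R]_n) :
  stationary P p -> h *m ones R n = 1%:M ->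
  1%:M - P + ones R n *m h \in unitmx.
Proof.
move=> [pP p1] h1; apply: unitmx_of_ker => z E.
have hz : h *m z = 0.
  have := congr1 (mulmx p) E.
  rewrite mulmxA mulmxDr mulmxBr mulmx1 pP subrr add0r mulmxA p1 mul1mx.
  by rewrite mulmx0.
have /harmonic_const[c zc] : P *m z = z.
  apply/eqP; rewrite eq_sym -subr_eq0 -{1}[z]mul1mx -mulmxBl.
  by move: E; rewrite mulmxDl -mulmxA hz mulmx0 addr0 => ->.
have := hz; rewrite zc -scalemxAr h1 => /matrixP/(_ 0 0).
by rewrite !mxE mulr1 => ->; rewrite scale0r.
Qed.

End Irreducible.

(** * Stochastic complements *)

Section StochasticComplement.
Variables (R : realType) (m k : nat).
Variables (P11 : 'M[R]_m) (P12 : 'M[R]_(m, k)) (P21 : 'M[R]_(k, m)).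
Variables (P22 : 'M[R]_k) (p1 : 'rV[R]_m) (p2 : 'rV[R]_k) (x y : R).
(** The setting is given by block equations so that it can be instantiated a second time with the
    two blocks exchanged, which handles P_2. *)
Hypothesis row1 : P11 *m ones R m + P12 *m ones R k = ones R m.
Hypothesis row2 : P21 *m ones R m + P22 *m ones R k = ones R k.
Hypothesis col2 : p1 *m P12 + p2 *m P22 = p2.
Hypothesis col1 : p1 *m P11 + p2 *m P21 = p1.
Hypothesis mass1 : p1 *m ones R m = x%:M.
Hypothesis mass2 : p2 *m ones R k = y%:M.
Hypothesis x_neq0 : x != 0.
Hypothesis xy1 : x + y = 1.
Hypothesis unit22 : 1%:M - P22 \in unitmx.
Hypothesis harmonic1 : forall z1 z2,
  P11 *m z1 + P12 *m z2 = z1 -> P21 *m z1 + P22 *m z2 = z2 ->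
  exists c, z1 = c *: ones R m.

Let A := invmx (1%:M - P22).
Let P1 := P11 + P12 *m A *m P21.
Let h1 := x^-1 *: p1.
Let T := 1%:M - P1 + ones R m *m h1.
Let Z1 := invmx T.
(** Mean number of steps spent in block 2 between a visit to a state of block 1 and the next visit
    to block 1. *)
Let w := P12 *m A *m ones R k.

(** Unit row sums give P21 1 = (I - P22) 1. In probabilistic terms, the chain leaves block 2 with
    probability 1. *)
Lemma complement_exit : A *m P21 *m ones R m = ones R k.
Proof.
have -> : A *m P21 *m ones R m = A *m ((1%:M - P22) *m ones R k).
  by rewrite mulmxBl mul1mx -[X in X - _]row2 addrK mulmxA.
by rewrite mulKmx.
Qed.

Lemma complement_row : P1 *m ones R m = ones R m.
Proof. by rewrite mulmxDl -!mulmxA [A *m _]mulmxA complement_exit. Qed.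

Lemma complement_flow : p1 *m P12 *m A = p2.
Proof.
have -> : p1 *m P12 = p2 *m (1%:M - P22).
  by rewrite mulmxBr mulmx1 -[X in X - _]col2 addrK.
by rewrite mulmxK.
Qed.

Lemma complement_mass : h1 *m ones R m = 1%:M.
Proof. by rewrite -scalemxAl mass1 scale_scalar_mx mulVf. Qed.

Lemma complement_stationary : h1 *m P1 = h1.
Proof.
by rewrite -scalemxAl mulmxDr !mulmxA complement_flow col1.
Qed.

Lemma complement_stationaryB : h1 *m T = h1.
Proof.
rewrite mulmxDr mulmxBr mulmx1 complement_stationary subrr add0r mulmxA.
by rewrite complement_mass mul1mx.
Qed.

(** A kernel vector z is fixed by [P1]; extended by A P21 z on block 2 it is harmonic for the whole
    chain, hence constant, and h1 z = 0 makes the constant 0. *)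
Lemma complement_unit : T \in unitmx.
Proof.
apply: unitmx_of_ker => z Tz0.
have hz : h1 *m z = 0 by rewrite -complement_stationaryB -mulmxA Tz0 mulmx0.
have P1z : P1 *m z = z.
  apply/eqP; rewrite eq_sym -subr_eq0 -{1}[z]mul1mx -mulmxBl.
  by move: Tz0; rewrite mulmxDl -mulmxA hz mulmx0 addr0 => ->.
have [|| c zc] := @harmonic1 z (A *m P21 *m z).
- by rewrite -{3}P1z mulmxDl !mulmxA.
- have : (1%:M - P22) *m (A *m P21 *m z) = P21 *m z by rewrite -mulmxA mulKVmx.
  by rewrite mulmxBl mul1mx => <-; rewrite subrK.
have := hz; rewrite zc -scalemxAr complement_mass => /matrixP/(_ 0 0).
by rewrite !mxE mulr1 => ->; rewrite scale0r.
Qed.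

Lemma complement_stationaryZ : h1 *m Z1 = h1.
Proof. by rewrite -{1}complement_stationaryB mulmxK // complement_unit. Qed.

Lemma complement_rowZ : Z1 *m ones R m = ones R m.
Proof.
have T1 : T *m ones R m = ones R m.
  rewrite mulmxDl mulmxBl mul1mx complement_row subrr add0r -mulmxA.
  by rewrite complement_mass mulmx1.
by rewrite -{1}T1 mulKmx // complement_unit.
Qed.

Lemma complement_exit_time : h1 *m w = (x^-1 * y)%:M.
Proof.
by rewrite !mulmxA -!scalemxAl complement_flow mass2 scale_scalar_mx.
Qed.

(* The upper left block Z11 of the inverse of I - P + 1 (h1, 0) is the inverse
   of the rank-one perturbation T + w h1 of T. *)
Lemma trace_complement_block Z11 Z21 :
  (1%:M - P11 + ones R m *m h1) *m Z11 - P12 *m Z21 = 1%:M ->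
  (ones R k *m h1 - P21) *m Z11 + (1%:M - P22) *m Z21 = 0 ->
  \tr Z11 = \tr Z1 - y.
Proof.
move=> E1 E2.
have Z21E : Z21 = A *m (P21 - ones R k *m h1) *m Z11.
  rewrite -[LHS](mulKmx unit22) -/A -mulmxA; congr (_ *m _).
  by apply/eqP; rewrite -subr_eq0 addrC -mulNmx opprB E2.
have TZ : T *m Z11 + w *m (h1 *m Z11) = 1%:M.
  rewrite -E1 Z21E !mulmxA -mulmxBl -mulmxDl; congr (_ *m _).
  rewrite mulmxBr !mulmxA /T /P1 /w opprB opprD !addrA.
  by rewrite -!addrA; congr (_ + (_ + _)); rewrite addrC -!addrA.
(* Multiplying [TZ] by h1 on the left leaves (1 + y / x) h1 Z11 = h1, and 1 + y / x = 1 / x. *)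
have hZ : h1 *m Z11 = x *: h1.
  have := congr1 (mulmx h1) TZ.
  rewrite mulmx1 mulmxDr [h1 *m (T *m _)]mulmxA [h1 *m (w *m _)]mulmxA.
  rewrite complement_stationaryB complement_exit_time.
  rewrite mul_scalar_mx -[X in X + _]scale1r -scalerDl.
  have -> : 1 + x^-1 * y = x^-1.
    by rewrite -[X in X + _](mulVf x_neq0) -mulrDr xy1 mulr1.
  by move=> hZ; rewrite -[in RHS]hZ scalerA mulfV // scale1r.
have Z11E : Z11 = Z1 - x *: (Z1 *m w *m h1).
  have uT := complement_unit.
  rewrite -[LHS](mulKmx uT) -/Z1; have -> : T *m Z11 = 1%:M - w *m (x *: h1).
    by rewrite -TZ hZ addrK.
  by rewrite mulmxBr mulmx1 -!scalemxAr mulmxA.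
(* Cyclicity of the trace turns the rank-one term into the scalar h1 Z1 w = h1 w = y / x. *)
rewrite Z11E raddfB /= linearZ /= mxtrace_mulC [h1 *m _]mulmxA.
rewrite complement_stationaryZ.
by rewrite complement_exit_time mxtrace_scalar mulrA mulfV // mul1r.
Qed.

(** The pair (v1, v2) solves (I - P) v = (0, 1) - y 1. Eliminating v2 gives v1 = x Z1 w + (d - y) 1
    with d = h1 v1, and g v2 = y then determines d. For g = h2 the right-hand side is x theta -
    y. *)
Lemma complement_potential (g : 'rV[R]_k) v1 v2 :
  g *m ones R k = 1%:M ->
  v1 - P11 *m v1 - P12 *m v2 + y *: ones R m = 0 ->
  v2 - P21 *m v1 - P22 *m v2 + y *: ones R k = ones R k ->
  g *m v2 = y%:M ->
  y - (h1 *m v1) 0 0 =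
  x * (g *m (1%:M + A *m P21 *m Z1 *m P12) *m A *m ones R k) 0 0 - y.
Proof.
move=> g1 E1 E2 gv2; set d := (h1 *m v1) 0 0.
have hv1 : h1 *m v1 = d%:M by apply: mx11_scalar.
have v2E : v2 = A *m P21 *m v1 + x *: (A *m ones R k).
  rewrite -[LHS](mulKmx unit22) -/A scalemxAr -mulmxA -mulmxDr; congr (_ *m _).
  apply/eqP; rewrite -subr_eq0 mulmxBl mul1mx opprD !addrA.
  rewrite [v2 - _ - _]addrAC -(addrK (y *: ones R k) (v2 - _ - _)) E2.
  by rewrite -[X in X - _ - _]scale1r -xy1 scalerDl addrK subrr.
have Tv1 : T *m v1 = x *: w - y *: ones R m + d *: ones R m.
  rewrite mulmxDl -mulmxA hv1 mul_mx_scalar; congr (_ + _).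
  rewrite mulmxBl mul1mx mulmxDl opprD addrA.
  move/eqP: E1; rewrite addr_eq0 {1}v2E mulmxDr opprD addrA subr_eq.
  by rewrite -scalemxAr !mulmxA => /eqP ->; rewrite addrC.
have v1E : v1 = x *: (Z1 *m w) + (d - y) *: ones R m.
  have uT := complement_unit.
  rewrite -[LHS](mulKmx uT) Tv1 -/Z1 mulmxDr mulmxBr -!scalemxAr.
  by rewrite complement_rowZ scalerBl addrA addrAC.
have := gv2; rewrite v2E mulmxDr v1E mulmxDr -!scalemxAr complement_exit.
rewrite mulmxDr -!scalemxAr g1 => /matrixP/(_ 0 0).
have -> : g *m (1%:M + A *m P21 *m Z1 *m P12) *m A *m ones R k =
          g *m (A *m ones R k) + g *m (A *m P21 *m (Z1 *m w)).
  by rewrite mulmxDr mulmx1 !mulmxDl !mulmxA.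
rewrite !mxE /= mulr1n => E.
lra.
Qed.

End StochasticComplement.

(** * Norms *)

Section Norms.
Variable R : realType.

Lemma norm_inf_ge0 m n (A : 'M[R]_(m, n)) : 0 <= norm_inf A.
Proof. exact: bigmax_ge_id. Qed.

Lemma row_le_norm_inf m n (A : 'M[R]_(m, n)) i :
  \sum_j `|A i j| <= norm_inf A.
Proof. exact: (le_bigmax 0 (fun i => \sum_j `|A i j|)). Qed.

Lemma norm_inf_le m n (A : 'M[R]_(m, n)) c :
  0 <= c -> (forall i, \sum_j `|A i j| <= c) -> norm_inf A <= c.
Proof. by move=> c0 Ac; apply: bigmax_le => // i _. Qed.

Lemma norm_infD m n (A B : 'M[R]_(m, n)) :
  norm_inf (A + B) <= norm_inf A + norm_inf B.
Proof.
apply: norm_inf_le => [|i]; first by rewrite addr_ge0 ?norm_inf_ge0.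
apply: le_trans (lerD (row_le_norm_inf A i) (row_le_norm_inf B i)).
by rewrite -big_split; apply: ler_sum => j _; rewrite mxE ler_normD.
Qed.

Lemma norm_l1D n (q1 q2 : 'rV[R]_n) :
  norm_l1 (q1 + q2) <= norm_l1 q1 + norm_l1 q2.
Proof. by rewrite -big_split; apply: ler_sum => j _; rewrite mxE ler_normD. Qed.

Lemma norm_l1_gt0 n (q : 'rV[R]_n) :
  (0 < n)%N -> (forall j, 0 < q 0 j) -> 0 < norm_l1 q.
Proof.
move=> n_gt0 q0; rewrite /norm_l1 (bigD1 (Ordinal n_gt0)) //=.
by rewrite ltr_pwDl ?sumr_ge0 // normr_gt0 gt_eqF.
Qed.

Lemma norm_l1M m n (q : 'rV[R]_m) (A : 'M[R]_(m, n)) :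
  norm_l1 (q *m A) <= norm_l1 q * norm_inf A.
Proof.
rewrite /norm_l1 mulr_suml.
apply: (@le_trans _ _ (\sum_j \sum_i `|q 0 i| * `|A i j|)).
  apply: ler_sum => j _; rewrite mxE; apply: le_trans (ler_norm_sum _ _ _) _.
  by apply: ler_sum => i _; rewrite normrM.
rewrite exchange_big; apply: ler_sum => i _; rewrite -mulr_sumr.
exact: ler_wpM2l (row_le_norm_inf A i).
Qed.

Lemma norm_infM m n l (A : 'M[R]_(m, n)) (B : 'M[R]_(n, l)) :
  norm_inf (A *m B) <= norm_inf A * norm_inf B.
Proof.
apply: norm_inf_le => [|i]; first by rewrite mulr_ge0 ?norm_inf_ge0.
have -> : \sum_j `|(A *m B) i j| = norm_l1 (row i A *m B).
  by rewrite -row_mul; apply: eq_bigr => j _; rewrite [in RHS]mxE.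
apply: le_trans (norm_l1M _ _) (ler_wpM2r (norm_inf_ge0 B) _).
by apply: le_trans (row_le_norm_inf A i); apply: ler_sum => j _; rewrite mxE.
Qed.

Lemma norm_inf_markov m n (A : 'M[R]_(m, n)) :
  nonneg_mx A -> A *m ones R n = ones R m -> norm_inf A <= 1.
Proof.
move=> A0 A1; apply: norm_inf_le => // i.
have /matrixP/(_ i 0) := A1; rewrite !mxE => <-.
by apply: ler_sum => j _; rewrite ger0_norm ?A0 // mxE mulr1.
Qed.

Lemma mass_le_norm_l1 n (q : 'rV[R]_n) : (q *m ones R n) 0 0 <= norm_l1 q.
Proof.
by rewrite mxE; apply: ler_sum => j _; rewrite mxE mulr1 ler_norm.
Qed.

Lemma norm_l1_nonneg n (q : 'rV[R]_n) :
  nonneg_mx q -> q *m ones R n = (norm_l1 q)%:M.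
Proof.
move=> q0; apply/matrixP=> i j; rewrite !ord1 !mxE mulr1n.
by apply: eq_bigr => l _; rewrite mxE mulr1 ger0_norm.
Qed.

End Norms.

(** * Partitioned chains *)

(** If B z = 0, monotonicity applies to both z and - z. *)
Lemma monotone_unit (R : realType) n (B : 'M[R]_n) :
  (forall z : 'cV_n, nonneg_mx (B *m z) -> nonneg_mx z) -> B \in unitmx.
Proof.
move=> mono; apply: unitmx_of_ker => z Bz0.
have z0 : nonneg_mx z by apply: mono => i j; rewrite Bz0 mxE.
have Nz0 : nonneg_mx (- z) by apply: mono => i j; rewrite mulmxN Bz0 oppr0 mxE.
apply/matrixP=> i j; rewrite [RHS]mxE; apply/eqP; rewrite eq_le -oppr_ge0.
by have := Nz0 i j; rewrite mxE => ->; apply: z0.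
Qed.

Section Partition.
Variables (R : realType) (m k : nat).
Hypotheses (m_gt0 : (0 < m)%N) (k_gt0 : (0 < k)%N).
Variables (P11 : 'M[R]_m) (P12 : 'M[R]_(m, k)) (P21 : 'M[R]_(k, m)).
Variables (P22 : 'M[R]_k) (p1 : 'rV[R]_m) (p2 : 'rV[R]_k).
Let P := block_mx P11 P12 P21 P22.
Hypothesis Psto : stochastic P.
Hypothesis Pirr : irreducible P.
Hypothesis pstat : stationary P (row_mx p1 p2).

Let x := norm_l1 p1.
Let y := norm_l1 p2.

Lemma ones_col_mx : ones R (m + k) = col_mx (ones R m) (ones R k).
Proof. by rewrite /ones col_mx_const. Qed.

Lemma partition_rows :
  P11 *m ones R m + P12 *m ones R k = ones R m /\
  P21 *m ones R m + P22 *m ones R k = ones R k.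
Proof. by have := Psto.2; rewrite ones_col_mx mul_block_col => /eq_col_mx. Qed.

Lemma partition_cols :
  p1 *m P11 + p2 *m P21 = p1 /\ p1 *m P12 + p2 *m P22 = p2.
Proof. by have := pstat.1; rewrite mul_row_block => /eq_row_mx. Qed.

Lemma partition_stationary_gt0 :
  (forall j, 0 < p1 0 j) /\ (forall j, 0 < p2 0 j).
Proof.
have pos := stationary_gt0 Pirr Psto pstat; split=> j.
  by have := pos (lshift k j); rewrite row_mxEl.
by have := pos (rshift m j); rewrite row_mxEr.
Qed.

Lemma partition_mass1 : p1 *m ones R m = x%:M.
Proof.
apply: norm_l1_nonneg => i j; rewrite ord1.
exact: ltW (partition_stationary_gt0.1 j).
Qed.

Lemma partition_mass2 : p2 *m ones R k = y%:M.
Proof.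
apply: norm_l1_nonneg => i j; rewrite ord1.
exact: ltW (partition_stationary_gt0.2 j).
Qed.

Lemma partition_gt0 : 0 < x /\ 0 < y.
Proof. by case: partition_stationary_gt0 => *; split; apply: norm_l1_gt0. Qed.

Lemma partition_mass : x + y = 1.
Proof.
have := pstat.2; rewrite ones_col_mx mul_row_col partition_mass1.
by rewrite partition_mass2 => /matrixP/(_ 0 0); rewrite !mxE !mulr1n.
Qed.

Lemma partition_nonneg :
  [/\ nonneg_mx P11, nonneg_mx P12, nonneg_mx P21 & nonneg_mx P22].
Proof.
have P0 := Psto.1; split=> i j.
- by have := P0 (lshift k i) (lshift k j); rewrite block_mxEul.
- by have := P0 (lshift k i) (rshift m j); rewrite block_mxEur.
- by have := P0 (rshift m i) (lshift k j); rewrite block_mxEdl.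
- by have := P0 (rshift m i) (rshift m j); rewrite block_mxEdr.
Qed.

Lemma partition_harmonic (z1 : 'cV_m) (z2 : 'cV_k) :
  P11 *m z1 + P12 *m z2 = z1 -> P21 *m z1 + P22 *m z2 = z2 ->
  exists c, z1 = c *: ones R m /\ z2 = c *: ones R k.
Proof.
move=> E1 E2; have [|c] := harmonic_const Pirr Psto (x := col_mx z1 z2).
  by rewrite mul_block_col E1 E2.
by rewrite ones_col_mx scale_col_mx => /eq_col_mx zc; exists c.
Qed.

(** Extended by 0 on block 1, z is superharmonic on block 2 and vanishes at some state of block 1, a
    nonempty block. *)
Lemma killed22_ge0 (z : 'cV[R]_k) :
  nonneg_mx ((1%:M - P22) *m z) -> nonneg_mx z.
Proof.
move=> z0 i j; rewrite ord1.
have := @superharmonic_ge0 _ _ _ Pirr Psto (col_mx 0 z)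
  (lshift k (Ordinal m_gt0)) _ _ (rshift m i).
rewrite col_mxEd; apply; first by rewrite col_mxEu mxE.
rewrite mul_block_col !mulmx0 !add0r => l; case: (split_ordP l) => l' ->.
  by rewrite col_mxEu mxE ltxx.
rewrite !col_mxEd => _; have := z0 l' 0.
by rewrite mulmxBl mul1mx !mxE subr_ge0.
Qed.

Lemma killed11_ge0 (z : 'cV[R]_m) :
  nonneg_mx ((1%:M - P11) *m z) -> nonneg_mx z.
Proof.
move=> z0 i j; rewrite ord1.
have := @superharmonic_ge0 _ _ _ Pirr Psto (col_mx z 0)
  (rshift m (Ordinal k_gt0)) _ _ (lshift k i).
rewrite col_mxEu; apply; first by rewrite col_mxEd mxE.
rewrite mul_block_col !mulmx0 !addr0 => l; case: (split_ordP l) => l' ->.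
  rewrite !col_mxEu => _; have := z0 l' 0.
  by rewrite mulmxBl mul1mx !mxE subr_ge0.
by rewrite col_mxEd mxE ltxx.
Qed.

Lemma killed22_unit : 1%:M - P22 \in unitmx.
Proof. exact: monotone_unit killed22_ge0. Qed.

Lemma killed11_unit : 1%:M - P11 \in unitmx.
Proof. exact: monotone_unit killed11_ge0. Qed.

(** I - P22 sends each column of its inverse to a unit vector, which is nonnegative. *)
Lemma killed22_inv_ge0 : nonneg_mx (invmx (1%:M - P22)).
Proof.
move=> i j; have := @killed22_ge0 (col j (invmx (1%:M - P22))) _ i 0.
rewrite mxE; apply => a b; rewrite colE mulmxA mulmxV ?killed22_unit //.
rewrite mul1mx !mxE.
by case: (_ && _).
Qed.

Let P1 := P11 + P12 *m invmx (1%:M - P22) *m P21.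
Let P2 := P22 + P21 *m invmx (1%:M - P11) *m P12.
Let h1 := x^-1 *: p1.
Let h2 := y^-1 *: p2.
Let Z1 := invmx (1%:M - P1 + ones R m *m h1).
Let theta := (h2 *m (1%:M + invmx (1%:M - P22) *m P21 *m Z1 *m P12)
  *m invmx (1%:M - P22) *m ones R k) 0 0.

Lemma theta_le :
  theta <= norm_inf (invmx (1%:M - P22)) * (1 + norm_inf P12 * norm_inf Z1).
Proof.
rewrite /theta; set A := invmx (1%:M - P22); set B := _ *m P12.
have [_ y0] := partition_gt0; have [_ _ P21_0 _] := partition_nonneg.
apply: le_trans (mass_le_norm_l1 _) _.
(* The row [h2] has 1-norm 1, so it drops out of the bound. *)
apply: (@le_trans _ _ (norm_inf ((1%:M + B) *m A))).
  rewrite -mulmxA; apply: le_trans (norm_l1M _ _) _.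
  suff -> : norm_l1 h2 = 1 by rewrite mul1r.
  rewrite /norm_l1 /h2 -[RHS](mulVf (lt0r_neq0 y0)) mulr_sumr.
  by apply: eq_bigr => j _; rewrite mxE normrM gtr0_norm ?invr_gt0.
have n1 : norm_inf (1%:M : 'M[R]_k) <= 1.
  by apply: norm_inf_markov; rewrite ?mul1mx // => i j; rewrite mxE; case: eqP.
have nAP : norm_inf (A *m P21) <= 1.
  apply: norm_inf_markov.
    move=> i j; rewrite mxE sumr_ge0 // => l _.
    by rewrite mulr_ge0 ?killed22_inv_ge0.
  exact: complement_exit partition_rows.2 killed22_unit.
apply: le_trans (norm_infM _ _) _; rewrite mulrC ler_wpM2l ?norm_inf_ge0 //.
apply: le_trans (norm_infD _ _) (lerD n1 _).
apply: le_trans (norm_infM _ _) _; rewrite mulrC ler_wpM2l ?norm_inf_ge0 //.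
apply: le_trans (norm_infM _ _) _; rewrite -[leRHS]mul1r.
by rewrite ler_wpM2r ?norm_inf_ge0.
Qed.

(* The blocks of Z = (I - P + 1 (h1, 0))^-1 and Z' = (I - P + 1 (0, h2))^-1
   with trace known from P1 and P2 are the upper left one of Z and the lower
   right one of Z'. The remaining block is exchanged through
   Z - Z' = 1 ((0, h2) - (h1, 0)) Z'. *)
Lemma kemeny_partition :
  kemeny P - kemeny P1 - kemeny P2 = ((theta + 1) * x - 1)%:C.
Proof.
have [row1 row2] := partition_rows; have [col1 col2] := partition_cols.
have [/lt0r_neq0 x0 /lt0r_neq0 y0] := partition_gt0.
(* The primed copies order the summands as needed when the blocks are exchanged. *)
have row1' := row1; rewrite addrC in row1'.
have row2' := row2; rewrite addrC in row2'.
have col1' := col1; rewrite addrC in col1'.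
have col2' := col2; rewrite addrC in col2'.
have mass1 := partition_mass1; have mass2 := partition_mass2.
have xy1 := partition_mass; have yx1 := xy1; rewrite addrC in yx1.
have u11 := killed11_unit; have u22 := killed22_unit.
have harm1 z1 z2 : P11 *m z1 + P12 *m z2 = z1 -> P21 *m z1 + P22 *m z2 = z2 ->
    exists c, z1 = c *: ones R m.
  by move=> E1 E2; have [c []] := partition_harmonic E1 E2; exists c.
have harm2 z2 z1 : P22 *m z2 + P21 *m z1 = z2 -> P12 *m z2 + P11 *m z1 = z1 ->
    exists c, z2 = c *: ones R k.
  rewrite addrC [X in _ -> X = _ -> _]addrC => E2 E1.
  by have [c []] := partition_harmonic E1 E2; exists c.
have hm1 : h1 *m ones R m = 1%:M := complement_mass mass1 x0.
have hm2 : h2 *m ones R k = 1%:M := complement_mass mass2 y0.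
pose h := row_mx h1 (0 : 'rV_k); pose h' := row_mx (0 : 'rV_m) h2.
have hone : h *m ones R (m + k) = 1%:M.
  by rewrite ones_col_mx mul_row_col mul0mx addr0.
have hone' : h' *m ones R (m + k) = 1%:M.
  by rewrite ones_col_mx mul_row_col mul0mx add0r.
have uh := fundamental_unit Pirr Psto pstat hone.
have uh' := fundamental_unit Pirr Psto pstat hone'.
have uT1 := complement_unit col2 col1 mass1 x0 u22 harm1.
have uT2 := complement_unit col1' col2' mass2 y0 u11 harm2.
rewrite (kemeny_trace Psto.2 hone uh).
rewrite (kemeny_trace (complement_row row1 row2 u22) hm1 uT1).
rewrite (kemeny_trace (complement_row row2' row1' u11) hm2 uT2).
rewrite -!rmorphB; congr (_%:C).
set Z := invmx _; set Z2 := invmx (1%:M - P2 + _).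
pose Z' := invmx (1%:M - P + ones R (m + k) *m h').
have ZE : Z = block_mx (ulsubmx Z) (ursubmx Z) (dlsubmx Z) (drsubmx Z).
  by rewrite submxK.
have Z'E : Z' = block_mx (ulsubmx Z') (ursubmx Z') (dlsubmx Z') (drsubmx Z').
  by rewrite submxK.
have IPE : 1%:M - P = block_mx (1%:M - P11) (- P12) (- P21) (1%:M - P22).
  by rewrite scalar_mx_block opp_block_mx add_block_mx !add0r.
have tr1 : \tr (ulsubmx Z) = \tr Z1 - y.
  have := mulmxV uh; rewrite -/Z IPE ones_col_mx mul_col_row !mulmx0.
  rewrite add_block_mx !addr0 [- P21 + _]addrC {1}ZE mulmx_block.
  rewrite scalar_mx_block !mulNmx => /eq_block_mx[E1 _ E2 _].
  exact: (trace_complement_block col2 col1 mass1 mass2 x0 xy1 u22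
    harm1 E1 E2).
have tr2 : \tr (drsubmx Z') = \tr Z2 - x.
  have := mulmxV uh'; rewrite -/Z' IPE ones_col_mx mul_col_row !mulmx0.
  rewrite add_block_mx !addr0 {1}Z'E mulmx_block scalar_mx_block.
  move=> /eq_block_mx[_ E2 _ E1]; rewrite mulNmx addrC in E1.
  rewrite addrC [- P12 + _]addrC in E2.
  exact: (trace_complement_block col1' col2' mass2 mass1 y0 yx1
    u11 harm2 E1 E2).
have ZZ' : Z - Z' = ones R (m + k) *m ((h' - h) *m Z').
  have Zone : Z *m ones R (m + k) = ones R (m + k).
    rewrite -[RHS](mulKmx uh) -/Z; congr (_ *m _).
    by rewrite mulmxDl mulmxBl mul1mx Psto.2 subrr add0r -mulmxA hone mulmx1.
  have ZI : Z *m (1%:M - P) = 1%:M - ones R (m + k) *m h.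
    by rewrite -[X in _ = X - _](mulVmx uh) -/Z [in RHS]mulmxDr mulmxA
      Zone addrK.
  (* Inserting I = (I - P + 1 h') Z' after Z and using [Zone] and [ZI] gives Z = (I - 1 h + 1 h')
     Z'. *)
  have E : Z = Z *m (1%:M - P + ones R (m + k) *m h') *m Z'.
    by rewrite mulmxK.
  rewrite {1}E mulmxDr mulmxA Zone ZI !mulmxDl mul1mx mulNmx mulmxDr !mulmxA.
  by rewrite mulmxN mulNmx addrC !addrA addNr add0r addrC.
(* The lower right block of 1 r has trace r (0, 1); for r = (h' - h) Z' this brings in the vector Z'
   (0, 1). *)
pose v := Z' *m col_mx (0 : 'cV_m) (ones R k).
pose v1 := usubmx v; pose v2 := dsubmx v.
have vE : v = col_mx v1 v2 by rewrite vsubmxK.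
have tr3 :
    \tr (drsubmx Z) - \tr (drsubmx Z') = (h2 *m v2) 0 0 - (h1 *m v1) 0 0.
  have -> : \tr (drsubmx Z) - \tr (drsubmx Z') = \tr (drsubmx (Z - Z')).
    rewrite -raddfB; congr (\tr _); apply/matrixP => i j.
    by rewrite !mxE.
  rewrite ZZ' ones_col_mx.
  set r := (h' - h) *m Z'; rewrite -[r]hsubmxK mul_col_row block_mxKdr.
  rewrite mxtrace_mulC trace_mx11.
  have -> : rsubmx r *m ones R k = r *m col_mx (0 : 'cV_m) (ones R k).
    by rewrite -{2}[r]hsubmxK mul_row_col mulmx0 add0r.
  rewrite /r -mulmxA -/v vE mulmxBl !mul_row_col !mul0mx addr0 add0r.
  by rewrite [LHS]mxE [X in _ + X]mxE.
have Iv : (1%:M - P) *m v + ones R (m + k) *m (h' *m v) =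
    col_mx (0 : 'cV_m) (ones R k).
  by rewrite [ones _ _ *m (h' *m v)]mulmxA -mulmxDl mulKVmx.
(* The stationary row annihilates I - P and has mass 1, which reduces [Iv] to h' v = y. *)
have h2v : h2 *m v2 = y%:M.
  have := congr1 (mulmx (row_mx p1 p2)) Iv.
  rewrite mulmxDr [_ *m ((_ - _) *m v)]mulmxA mulmxBr mulmx1 pstat.1 subrr.
  rewrite mul0mx add0r [_ *m (ones _ _ *m _)]mulmxA pstat.2 mul1mx.
  rewrite mul_row_col mulmx0 add0r mass2 => <-.
  by rewrite vE mul_row_col mul0mx add0r.
have hv : h' *m v = y%:M by rewrite vE mul_row_col mul0mx add0r.
move: Iv; rewrite hv mul_mx_scalar IPE {1}vE mul_block_col ones_col_mx.
rewrite scale_col_mx add_col_mx => /eq_col_mx[].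
rewrite !mulmxBl !mul1mx !mulNmx [- (P21 *m _) + _]addrC => E1 E2.
rewrite [_ - P22 *m _ - _]addrAC in E2.
have := complement_potential row1 row2 col2 col1 mass1 x0 xy1 u22 harm1 hm2
  E1 E2 h2v.
rewrite -/P1 -/h1 -/Z1 -/theta => D.
(* Now tr Z = (tr Z1 - y) + (tr Z2 - x) + (x theta - y), and the constants of the three trace
   formulas add up to 1. *)
rewrite ZE mxtrace_block tr1.
rewrite -[\tr (drsubmx Z)](subrK (\tr (drsubmx Z'))) tr3.
rewrite tr2 h2v [y%:M _ _]mxE mulr1n D.
have -> : y = 1 - x by rewrite -xy1 addrC addKr.
ring.
Qed.

Lemma partition_norm_bounds :
  norm_inf P11 < 1 -> norm_inf P22 < 1 ->
  (1 - norm_inf P22) / (1 - norm_inf P22 + norm_inf P12) <= x <=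
  norm_inf P21 / (1 - norm_inf P11 + norm_inf P21).
Proof.
move=> P11_lt1 P22_lt1; have [x0 y0] := partition_gt0.
have [col1 col2] := partition_cols.
have n12 := norm_inf_ge0 P12; have n21 := norm_inf_ge0 P21.
have b1 : x <= x * norm_inf P11 + y * norm_inf P21.
  rewrite {1}/x -col1; apply: le_trans (norm_l1D _ _) _.
  by apply: lerD; apply: norm_l1M.
have b2 : y <= x * norm_inf P12 + y * norm_inf P22.
  rewrite {1}/y -col2; apply: le_trans (norm_l1D _ _) _.
  by apply: lerD; apply: norm_l1M.
have yE : y = 1 - x by rewrite -partition_mass addrC addKr.
rewrite yE in b1 b2.
(* The norm assumptions make both denominators positive; once they are cleared, [b2] is the lower
   bound and [b1] the upper one. *)
rewrite ler_pdivrMr ?ler_pdivlMr; first by apply/andP; split; lra.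
  by rewrite ltr_pwDl // subr_gt0.
by rewrite ltr_pwDl // subr_gt0.
Qed.

End Partition.

Theorem mainTheorem9 (R : realType) (m k : nat) (hm : (0 < m)%N) (hk : (0 < k)%N)
    (P : 'M[R]_(m + k)) (p : 'rV[R]_(m + k))
    (hP : stochastic P) (hirr : irreducible P) (hp : stationary P p) :
  let P11 := ulsubmx P in
  let P12 := ursubmx P in
  let P21 := dlsubmx P in
  let P22 := drsubmx P in
  let P1 : 'M[R]_m := P11 + P12 *m invmx (1%:M - P22) *m P21 in
  let P2 : 'M[R]_k := P22 + P21 *m invmx (1%:M - P11) *m P12 in
  let p1 := lsubmx p in
  let p2 := rsubmx p in
  let hatp1 := (norm_l1 p1)^-1 *: p1 in
  let hatp2 := (norm_l1 p2)^-1 *: p2 in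
  let gamma : R[i] := kemeny P - kemeny P1 - kemeny P2 in
  let Z1 : 'M[R]_m := invmx (1%:M - P1 + ones R m *m hatp1) in
  let theta : R :=
    (hatp2 *m (1%:M + invmx (1%:M - P22) *m P21 *m Z1 *m P12)
           *m invmx (1%:M - P22) *m ones R k) 0 0 in
  let lo : R := (1 - norm_inf P22) / (1 - norm_inf P22 + norm_inf P12) in
  let up : R := norm_inf P21 / (1 - norm_inf P11 + norm_inf P21) in
  [/\ theta <= norm_inf (invmx (1%:M - P22))
               * (1 + norm_inf P12 * norm_inf Z1),
      norm_inf P11 < 1 -> norm_inf P22 < 1 -> lo <= norm_l1 p1 <= up,
      norm_inf P11 < 1 -> norm_inf P22 < 1 -> 0 <= 1 + theta ->
        ((theta + 1) * lo - 1)%:C <= gamma <= ((theta + 1) * up - 1)%:C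
    & norm_inf P11 < 1 -> norm_inf P22 < 1 -> 1 + theta < 0 ->
        ((theta + 1) * up - 1)%:C <= gamma <= ((theta + 1) * lo - 1)%:C].
Proof.
move=> P11 P12 P21 P22 P1 P2 p1 p2 hatp1 hatp2 gamma Z1 theta lo up.
have PE : P = block_mx P11 P12 P21 P22 by rewrite submxK.
have pE : p = row_mx p1 p2 by rewrite hsubmxK.
rewrite PE in hP hirr; rewrite PE pE in hp.
have bounds := partition_norm_bounds hm hk hP hirr hp.
(* As gamma is affine in the mass of block 1 with slope theta + 1, the sign of the slope decides
   which bound on the mass gives which bound on gamma. *)
have gammaE : gamma = ((theta + 1) * norm_l1 p1 - 1)%:C.
  by rewrite /gamma {1}PE (kemeny_partition hm hk hP hirr hp).
split; first exact: (theta_le hm hk hP hirr hp).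
- exact: bounds.
- move=> n11 n22 th; have /andP[b1 b2] := bounds n11 n22.
  rewrite addrC in th; rewrite gammaE !lecR !lerD2r.
  by rewrite !ler_wpM2l.
- move=> n11 n22 /ltW th; have /andP[b1 b2] := bounds n11 n22.
  rewrite addrC in th; rewrite gammaE !lecR !lerD2r.
  by rewrite !ler_wnM2l.
Qed.
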